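(* Let $d\ge1$, $\alpha\ge0$, and let $M=\bigoplus_{l=1}^r M_l$ be an upset-decomposable module over $\mathbb{R}^d$, each $M_l$ an upset module. Then for every $l_1\in\{1,\dots,r\}$, \[ \pi_{l_1}\bigl(\mathrm{Pru}_\alpha(M)\bigr)=\bigcap_{l\in JM_{l_1}}M_l(-\alpha), \] where $JM_{l_1}$ is the set of all $l\in\{1,\dots,r\}$ such that there is a directed path (possibly of length $0$) from $M_{l_1}$ to $M_l$ in the directed graph $G(M,\alpha)$.
   Context: Fix a field $k$. $\mathbb{R}^d$ carries the product order; for $\varepsilon\in\mathbb{R}$ and $p\in\mathbb{R}^d$ write $p+\varepsilon:=p+(\varepsilon,\dots,\varepsilon)$. A (persistence) module is a functor $M$ from the poset $\mathbb{R}^d$ to $k$-vector spaces, with spaces $M_p$ and maps $M_{p\to q}$ for $p\le q$; morphisms are natural transformations; direct sums, submodules, images, preimages and quotients are pointwise. The shift $M(\varepsilon)$ is $M(\varepsilon)_p=M_{p+\varepsilon}$, $M(\varepsilon)_{p\to q}=M_{p+\varepsilon\to q+\varepsilon}$; for $\varepsilon\le\delta$, $M_{\varepsilon\to\delta}:M(\varepsilon)\to M(\delta)$ is given at $p$ by $M_{p+\varepsilon\to p+\delta}$. Upset modules: an upset is $U\subseteq\mathbb{R}^d$ such that $p\in U$, $q\ge p$ imply $q\in U$. The associated upset module has $M_p=k$ for $p\in U$, $M_p=0$ otherwise, with $M_{p\to q}=\mathrm{Id}_k$ for $p\in U$, $p\le q$; its support is $\mathrm{supp}(M)=U$. A module is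 upset-decomposable if it is isomorphic to a direct sum of upset modules. For upset modules, $M\subseteq N$ means $\mathrm{supp}(M)\subseteq\mathrm{supp}(N)$, and an intersection of upset modules is the upset module supported on the intersection of the supports. Graph: $G(M,\alpha)$ is the directed graph with $r$ vertices $M_1,\dots,M_r$ (one for each index), with an edge $M_{l_1}\to M_{l_2}$ if and only if $M_{l_1}\subseteq M_{l_2}(2\alpha)$. Pruning: for $\alpha\ge 0$ let $I$ be the largest submodule of $M$ such that $f(I)\subseteq M_{0\to2\alpha}(I)$ for every morphism $f:M\to M(2\alpha)$, and let $K$ be the smallest submodule of $I$ such that $(I_{0\to2\alpha})^{-1}(f(K))\subseteq K$ for every morphism $f:M\to M(2\alpha)$ (both exist). The $\alpha$-pruning of $M$ is $\mathrm{Pru}_\alpha(M):=(I/K)(-\alpha)$. For upset-decomposable $M$ one has $K=0$, so $\mathrm{Pru}_\alpha(M)$ is regarded as the submodule $I(-\alpha)$ of $M(-\alpha)=\bigoplus_l M_l(-\alpha)$, and $\pi_{l_1}$ denotes the canonical projection onto the summand with index $l_1$, so that $\pi_{l_1}(\mathrm{Pru}_\alpha(M))=\pi_{l_1}(I)(-\alpha)$. *)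

(* Defs.v *)
From HB Require Import structures.
From mathcomp Require Import all_boot all_order all_algebra.
From mathcomp Require Import boolp classical_sets reals.

Set Implicit Arguments.
Unset Strict Implicit.
Unset Printing Implicit Defensive.

Import Order.TTheory GRing.Theory Num.Theory.

Local Open Scope ring_scope.
Local Open Scope classical_set_scope.
Local Open Scope quotient_scope.

Section Points.
Variables (R : realType) (d : nat).
Implicit Types (p q s : 'rV[R]_d) (e : R).

Definition ple p q : bool := [forall i, p 0 i <= q 0 i].

Lemma ple_refl p : ple p p.
Proof. by apply/forallP => i; exact: lexx. Qed.

Lemma ple_trans p q s : ple p q -> ple q s -> ple p s.
Proof.
move=> /forallP pq /forallP qs; apply/forallP => i; exact: le_trans (pq i) (qs i).
Qed.

Definition padd p e : 'rV[R]_d := p + const_mx e.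

Lemma ple_padd2r p q e : ple p q -> ple (padd p e) (padd q e).
Proof. by move=> /forallP pq; apply/forallP => i; rewrite !mxE lerD2r. Qed.

Lemma ple_paddr p e : 0 <= e -> ple p (padd p e).
Proof. by move=> e0; apply/forallP => i; rewrite !mxE lerDl. Qed.

End Points.

Section Modules.
Variables (R : realType) (d : nat) (k : fieldType).

Record pmod := Pmod {
  space :> 'rV[R]_d -> lmodType k;
  pmap : forall p q, ple p q -> {linear space p -> space q};
  pmap_id : forall p (h : ple p p) x, pmap h x = x;
  pmap_comp : forall p q s (pq : ple p q) (qs : ple q s) (ps : ple p s) x,
    pmap qs (pmap pq x) = pmap ps x }.

Record pmor (M N : pmod) := Pmor {
  pmor_at :> forall p, {linear M p -> N p};
  pmor_nat : forall p q (h : ple p q) x,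
    pmor_at q (pmap M h x) = pmap N h (pmor_at p x) }.

Section Comp.
Variables (M N P : pmod) (g : pmor N P) (f : pmor M N).

Let comp_at p : {linear M p -> P p} := g p \o f p.

Lemma pmor_comp_nat p q (h : ple p q) x :
  comp_at q (pmap M h x) = pmap P h (comp_at p x).
Proof. by rewrite /= !pmor_nat. Qed.

Definition pmor_comp : pmor M P := Pmor pmor_comp_nat.
End Comp.

Definition pmod_iso (M N : pmod) : Prop :=
  exists f : pmor M N, forall p, bijective (f p).

Section Shift.
Variables (M : pmod) (e : R).

Let shift_space p : lmodType k := M (padd p e).
Let shift_pmap p q (h : ple p q) : {linear shift_space p -> shift_space q} :=
  pmap M (ple_padd2r e h).

Lemma shift_id p (h : ple p p) x : shift_pmap h x = x.
Proof. exact: pmap_id. Qed.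

Lemma shift_comp p q s (pq : ple p q) (qs : ple q s) (ps : ple p s) x :
  shift_pmap qs (shift_pmap pq x) = shift_pmap ps x.
Proof. exact: pmap_comp. Qed.

Definition pshift : pmod := Pmod shift_id shift_comp.
End Shift.

Section ShiftMor.
Variables (M N : pmod) (f : pmor M N) (e : R).

Let shift_at p : {linear pshift M e p -> pshift N e p} := f (padd p e).

Lemma shift_mor_nat p q (h : ple p q) x :
  shift_at q (pmap (pshift M e) h x) = pmap (pshift N e) h (shift_at p x).
Proof. exact: (pmor_nat f (ple_padd2r e h) x). Qed.

Definition shift_mor : pmor (pshift M e) (pshift N e) := Pmor shift_mor_nat.
End ShiftMor.

(** The transition morphism M_{0 -> e} : M -> M(e). *)
Section Transition.
Variables (M : pmod) (e : R) (e0 : 0 <= e).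

Let trans_at p : {linear M p -> pshift M e p} := pmap M (ple_paddr p e0).

Lemma transition_nat p q (h : ple p q) x :
  trans_at q (pmap M h x) = pmap (pshift M e) h (trans_at p x).
Proof.
have pq : ple p (padd q e) by apply: ple_trans h _; exact: ple_paddr.
by rewrite /= !(pmap_comp _ _ pq).
Qed.

Definition transition : pmor M (pshift M e) := Pmor transition_nat.
End Transition.

Definition supp (M : pmod) : set 'rV[R]_d := [set p | exists x : M p, x <> 0].

Record submodule (M : pmod) := Submodule {
  sub_at :> forall p, {pred M p};
  sub_closed : forall p, subsemimod_closed (@sub_at p);
  sub_stable : forall p q (h : ple p q) x, x \in @sub_at p -> pmap M h x \in @sub_at q }.
Arguments sub_at {M} s p _ : rename.

HB.instance Definition _ M (N : submodule M) p :=
  GRing.isSubmodClosed.Build k (M p) (sub_at N p) (sub_closed N p).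

Definition sub_le M (N P : submodule M) : Prop := forall p, {subset N p <= P p}.

Definition sub_eq M (N P : submodule M) : Prop := forall p, N p =i P p.

Section SubPmod.
Variables (M : pmod) (N : submodule M).

Record sub_elt p := SubElt { sub_val :> M p; sub_valP : sub_val \in N p }.

HB.instance Definition _ p := [isSub of sub_elt p for @sub_val p].
HB.instance Definition _ p := [Choice of sub_elt p by <:].
HB.instance Definition _ p := [SubChoice_isSubLmodule of sub_elt p by <:].

Section Map.
Variables (p q : 'rV[R]_d) (h : ple p q).

Definition sub_map (x : sub_elt p) : sub_elt q :=
  SubElt (sub_stable h (sub_valP x)).

Lemma sub_map_linear : linear sub_map.
Proof. by move=> a x y; apply: val_inj; rewrite /= !linearP. Qed.

HB.instance Definition _ := GRing.isLinear.Build k (sub_elt p) (sub_elt q) _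
  sub_map sub_map_linear.
End Map.

Let sub_space p : lmodType k := sub_elt p.
Let sub_pmap p q (h : ple p q) : {linear sub_space p -> sub_space q} := sub_map h.

Lemma sub_pmap_id p (h : ple p p) x : sub_pmap h x = x.
Proof. by apply: val_inj; exact: pmap_id. Qed.

Lemma sub_pmap_comp p q s (pq : ple p q) (qs : ple q s) (ps : ple p s) x :
  sub_pmap qs (sub_pmap pq x) = sub_pmap ps x.
Proof. by apply: val_inj; exact: pmap_comp. Qed.

Definition sub_pmod : pmod := Pmod sub_pmap_id sub_pmap_comp.

Let incl_at p : {linear sub_pmod p -> M p} := val : sub_elt p -> M p.

Lemma sub_incl_nat p q (h : ple p q) x :
  incl_at q (pmap sub_pmod h x) = pmap M h (incl_at p x).
Proof. by []. Qed.

Definition sub_incl : pmor sub_pmod M := Pmor sub_incl_nat.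
End SubPmod.

Section QuotPmod.
Variables (M : pmod) (N : submodule M).

Definition quot_elt p := Quotient.quot (N p).
HB.instance Definition _ p := GRing.Zmodule.on (quot_elt p).
HB.instance Definition _ p := EqQuotient.on (quot_elt p).

Definition quot_pi p (x : M p) : quot_elt p := \pi_(quot_elt p) x.

Lemma quot_piE p (x y : M p) : (quot_pi x == quot_pi y) = (x - y \in N p).
Proof. by rewrite Quotient.idealrBE. Qed.

Lemma quot_pi_repr p (u : quot_elt p) : quot_pi (repr u) = u.
Proof. exact: reprK. Qed.

Lemma quot_piD p (x y : M p) : quot_pi (x + y) = quot_pi x + quot_pi y.
Proof. exact: (raddfD (\pi_(Quotient.quot (N p)))). Qed.

Section Scale.
Variable p : 'rV[R]_d.

Definition quot_scale (a : k) (u : quot_elt p) : quot_elt p :=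
  quot_pi (a *: repr u).

Lemma quot_scale_pi a x : quot_scale a (quot_pi x) = quot_pi (a *: x).
Proof.
apply/eqP; rewrite quot_piE -scalerBr rpredZ // -quot_piE quot_pi_repr eqxx //.
Qed.

Lemma quot_scaleA a b u : quot_scale a (quot_scale b u) = quot_scale (a * b) u.
Proof. by rewrite -[u]quot_pi_repr !quot_scale_pi scalerA. Qed.

Lemma quot_scale1 : left_id 1 quot_scale.
Proof. by move=> u; rewrite -[u]quot_pi_repr quot_scale_pi scale1r. Qed.

Lemma quot_scaleDr : right_distributive quot_scale +%R.
Proof.
move=> a u v; rewrite -[u]quot_pi_repr -[v]quot_pi_repr.
by rewrite -quot_piD !quot_scale_pi scalerDr quot_piD.
Qed.

Lemma quot_scaleDl u : {morph quot_scale^~ u : a b / a + b}.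
Proof.
by move=> a b; rewrite -[u]quot_pi_repr !quot_scale_pi scalerDl quot_piD.
Qed.

HB.instance Definition _ := GRing.Zmodule_isLmodule.Build k (quot_elt p)
  quot_scaleA quot_scale1 quot_scaleDr quot_scaleDl.

Lemma quot_pi_linear : linear (@quot_pi p).
Proof. by move=> a x y; rewrite quot_piD -quot_scale_pi. Qed.

HB.instance Definition _ := GRing.isLinear.Build k (M p) (quot_elt p) _
  (@quot_pi p) quot_pi_linear.
End Scale.

Section Map.
Variables (p q : 'rV[R]_d) (h : ple p q).

Definition quot_map (u : quot_elt p) : quot_elt q := quot_pi (pmap M h (repr u)).

Lemma quot_map_pi x : quot_map (quot_pi x) = quot_pi (pmap M h x).
Proof.
apply/eqP; rewrite quot_piE -linearB sub_stable // -quot_piE quot_pi_repr eqxx //.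
Qed.

Lemma quot_map_linear : linear quot_map.
Proof.
move=> a u v; rewrite -[u]quot_pi_repr -[v]quot_pi_repr -linearP.
by rewrite !quot_map_pi !linearP.
Qed.

HB.instance Definition _ := GRing.isLinear.Build k (quot_elt p) (quot_elt q) _
  quot_map quot_map_linear.
End Map.

Let quot_space p : lmodType k := quot_elt p.
Let quot_pmap p q (h : ple p q) : {linear quot_space p -> quot_space q} :=
  quot_map h.

Lemma quot_pmap_id p (h : ple p p) u : quot_pmap h u = u.
Proof. by rewrite -[u]quot_pi_repr /= quot_map_pi pmap_id. Qed.

Lemma quot_pmap_comp p q s (pq : ple p q) (qs : ple q s) (ps : ple p s) u :
  quot_pmap qs (quot_pmap pq u) = quot_pmap ps u.
Proof.
by rewrite -[u]quot_pi_repr /= !quot_map_pi (pmap_comp _ _ ps).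
Qed.

Definition quot_pmod : pmod := Pmod quot_pmap_id quot_pmap_comp.

Let proj_at p : {linear M p -> quot_pmod p} := @quot_pi p.

Lemma quot_proj_nat p q (h : ple p q) x :
  proj_at q (pmap M h x) = pmap quot_pmod h (proj_at p x).
Proof. by rewrite /= quot_map_pi. Qed.

Definition quot_proj : pmor M quot_pmod := Pmor quot_proj_nat.

Section Trivial.
Hypothesis N0 : forall p x, x \in N p -> x = 0.

Let unquot p (u : quot_elt p) : M p := repr u.

Lemma unquot_pi p (x : M p) : unquot (quot_pi x) = x.
Proof.
by apply/eqP; rewrite -subr_eq0; apply/eqP/N0; rewrite -quot_piE quot_pi_repr.
Qed.

Lemma unquot_linear p : linear (@unquot p).
Proof.
move=> a u v; rewrite -[u]quot_pi_repr -[v]quot_pi_repr -linearP.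
by rewrite !unquot_pi.
Qed.

HB.instance Definition _ p := GRing.isLinear.Build k (quot_elt p) (M p) _
  (@unquot p) (@unquot_linear p).

Let unquot_at p : {linear quot_pmod p -> M p} := @unquot p.

Lemma unquot_nat p q (h : ple p q) u :
  unquot_at q (pmap quot_pmod h u) = pmap M h (unquot_at p u).
Proof. by rewrite -[u]quot_pi_repr /= quot_map_pi !unquot_pi. Qed.

Definition quot0_inv : pmor quot_pmod M := Pmor unquot_nat.

Lemma quot_projK p x : quot0_inv p (quot_proj p x) = x.
Proof. exact: unquot_pi. Qed.

End Trivial.
End QuotPmod.

Section ImPreim.
Variables (M N : pmod) (f : pmor M N).

Section Image.
Variable S : submodule M.

Definition image_at p : {pred N p} :=
  [pred y | `[< exists2 x, x \in S p & f p x = y >]].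

Lemma image_closed p : subsemimod_closed (@image_at p).
Proof.
split; first split.
- by apply/asboolP; exists 0; rewrite ?rpred0 ?linear0.
- move=> _ _ /asboolP[x xS <-] /asboolP[y yS <-].
  by apply/asboolP; exists (x + y); rewrite ?rpredD ?linearD.
- move=> a _ /asboolP[x xS <-].
  by apply/asboolP; exists (a *: x); rewrite ?rpredZ ?linearZ.
Qed.

Lemma image_stable p q (h : ple p q) y :
  y \in @image_at p -> pmap N h y \in @image_at q.
Proof.
move=> /asboolP[x xS <-]; apply/asboolP.
by exists (pmap M h x); rewrite ?sub_stable ?pmor_nat.
Qed.

Definition sub_image : submodule N := Submodule image_closed image_stable.
End Image.

Section Preimage.
Variable S : submodule N.

Definition preimage_at p : {pred M p} := [pred x | f p x \in S p].

Lemma preimage_closed p : subsemimod_closed (@preimage_at p).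
Proof.
split; first split.
- by rewrite inE linear0 rpred0.
- by move=> x y; rewrite !inE linearD; exact: rpredD.
- by move=> a x; rewrite !inE linearZ; exact: rpredZ.
Qed.

Lemma preimage_stable p q (h : ple p q) x :
  x \in @preimage_at p -> pmap M h x \in @preimage_at q.
Proof. by rewrite !inE pmor_nat; exact: sub_stable. Qed.

Definition sub_preimage : submodule M := Submodule preimage_closed preimage_stable.
End Preimage.
End ImPreim.

Section FullSub.
Variable M : pmod.

Let full_at p : {pred M p} := predT.

Lemma full_closed p : subsemimod_closed (@full_at p).
Proof. by []. Qed.

Lemma full_stable p q (h : ple p q) x : x \in @full_at p -> pmap M h x \in @full_at q.
Proof. by []. Qed.

Definition full : submodule M := Submodule full_closed full_stable.
End FullSub.

Definition im (M N : pmod) (f : pmor M N) : submodule N := sub_image f (full M).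

Section Pruning.
Variables (M : pmod) (e : R) (e0 : 0 <= e).

Definition pruI_cond (I : submodule M) : Prop :=
  forall f : pmor M (pshift M e), sub_le (sub_image f I) (sub_image (transition M e0) I).

(** The largest such I, obtained as the union of all of them. *)
Let pruI_at p : {pred M p} :=
  [pred x | `[< exists2 I : submodule M, pruI_cond I & x \in I p >]].

Section Sum.
Variables I J : submodule M.

Let sum_at p : {pred M p} :=
  [pred z | `[< exists x y, [/\ x \in I p, y \in J p & z = x + y] >]].

Lemma sum_closed p : subsemimod_closed (@sum_at p).
Proof.
split; first split.
- by apply/asboolP; exists 0, 0; rewrite !rpred0 addr0.
- move=> _ _ /asboolP[x [y [xI yJ ->]]] /asboolP[x' [y' [xI' yJ' ->]]].
  by apply/asboolP; exists (x + x'), (y + y'); rewrite !rpredD // addrACA.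
- move=> a _ /asboolP[x [y [xI yJ ->]]].
  by apply/asboolP; exists (a *: x), (a *: y); rewrite !rpredZ // scalerDr.
Qed.

Lemma sum_stable p q (h : ple p q) x : x \in @sum_at p -> pmap M h x \in @sum_at q.
Proof.
move=> /asboolP[y [z [yI zJ ->]]]; apply/asboolP.
by exists (pmap M h y), (pmap M h z); rewrite !sub_stable // linearD.
Qed.

Definition sum_sub : submodule M := Submodule sum_closed sum_stable.

Lemma mem_suml p x : x \in I p -> x \in sum_sub p.
Proof. by move=> xI; apply/asboolP; exists x, 0; rewrite rpred0 addr0. Qed.

Lemma mem_sumr p x : x \in J p -> x \in sum_sub p.
Proof. by move=> xI; apply/asboolP; exists 0, x; rewrite rpred0 add0r. Qed.

Lemma sum_cond : pruI_cond I -> pruI_cond J -> pruI_cond sum_sub.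
Proof.
move=> cI cJ f p _ /asboolP[_ /asboolP[x [y [xI yJ ->]]] <-].
have /asboolP[x' xI' ex] : f p x \in sub_image (transition M e0) I p.
  by apply: (cI f); apply/asboolP; exists x.
have /asboolP[y' yJ' ey] : f p y \in sub_image (transition M e0) J p.
  by apply: (cJ f); apply/asboolP; exists y.
apply/asboolP; exists (x' + y'); last by rewrite !linearD ex ey.
by apply: rpredD; [exact: mem_suml | exact: mem_sumr].
Qed.
End Sum.

Lemma zero_closed p : subsemimod_closed (pred1 (0 : M p)).
Proof.
split; first split; first by rewrite inE.
- by move=> x y; rewrite !inE => /eqP-> /eqP->; rewrite addr0.
- by move=> a x; rewrite !inE => /eqP->; rewrite scaler0.
Qed.

Lemma zero_stable p q (h : ple p q) x :
  x \in pred1 (0 : M p) -> pmap M h x \in pred1 (0 : M q).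
Proof. by rewrite !inE => /eqP->; rewrite linear0. Qed.

Definition zero_sub : submodule M := Submodule zero_closed zero_stable.

Lemma zero_cond : pruI_cond zero_sub.
Proof.
move=> f p _ /asboolP[x /eqP-> <-]; apply/asboolP.
by exists 0; rewrite ?linear0 // inE.
Qed.

Lemma pruI_closed p : subsemimod_closed (@pruI_at p).
Proof.
split; first split.
- by apply/asboolP; exists zero_sub; [exact: zero_cond | rewrite rpred0].
- move=> x y /asboolP[I cI xI] /asboolP[J cJ yJ]; apply/asboolP.
  exists (sum_sub I J); first exact: sum_cond.
  by apply: rpredD; [exact: mem_suml | exact: mem_sumr].
- move=> a x /asboolP[I cI xI]; apply/asboolP.
  by exists I; rewrite ?rpredZ.
Qed.

Lemma pruI_stable p q (h : ple p q) x : x \in @pruI_at p -> pmap M h x \in @pruI_at q.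
Proof.
by move=> /asboolP[I cI xI]; apply/asboolP; exists I; rewrite ?sub_stable.
Qed.

Definition pruI : submodule M := Submodule pruI_closed pruI_stable.

Lemma pruI_largest :
  pruI_cond pruI /\ forall I, pruI_cond I -> sub_le I pruI.
Proof.
split=> [f p _ /asboolP[x /asboolP[I cI xI] <-]|I cI p x xI]; last first.
  by apply/asboolP; exists I.
have /asboolP[x' xI' ex] : f p x \in sub_image (transition M e0) I p.
  by apply: (cI f); apply/asboolP; exists x.
by apply/asboolP; exists x' => //; apply/asboolP; exists I.
Qed.

(** (I_{0 -> e})^{-1}(f(K)) <= K for all f : M -> M(e), where I = pruI; both
    f(K) and the target I(e) of I_{0 -> e} are compared inside M(e). *)
Definition pruK_cond (K : submodule (sub_pmod pruI)) : Prop :=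
  forall f : pmor M (pshift M e),
    sub_le
      (sub_preimage (pmor_comp (shift_mor (sub_incl pruI) e)
                           (transition (sub_pmod pruI) e0))
                (sub_image (pmor_comp f (sub_incl pruI)) K))
      K.

(** The smallest such K, obtained as the intersection of all of them. *)
Let pruK_at p : {pred sub_pmod pruI p} :=
  [pred x | `[< forall K, pruK_cond K -> x \in K p >]].

Lemma pruK_closed p : subsemimod_closed (@pruK_at p).
Proof.
split; first split.
- by apply/asboolP => K _; exact: rpred0.
- move=> x y /asboolP xK /asboolP yK; apply/asboolP => K cK.
  by rewrite rpredD ?xK ?yK.
- by move=> a x /asboolP xK; apply/asboolP => K cK; rewrite rpredZ ?xK.
Qed.

Lemma pruK_stable p q (h : ple p q) x :
  x \in @pruK_at p -> pmap (sub_pmod pruI) h x \in @pruK_at q.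
Proof.
by move=> /asboolP xK; apply/asboolP => K cK; rewrite sub_stable ?xK.
Qed.

Definition pruK : submodule (sub_pmod pruI) := Submodule pruK_closed pruK_stable.

Lemma pruK_smallest :
  pruK_cond pruK /\ forall K, pruK_cond K -> sub_le pruK K.
Proof.
split=> [f p x xfK|K cK p x /asboolP]; last exact.
apply/asboolP => K cK; apply: (cK f).
move: xfK => /asboolP[y /asboolP yK exy].
by apply/asboolP; exists y => //; exact: yK.
Qed.

End Pruning.

Lemma double_ge0 (a : R) : 0 <= a -> 0 <= 2 * a.
Proof. by move=> a0; rewrite mulr_ge0. Qed.

Definition pruning (a : R) (a0 : 0 <= a) (M : pmod) : pmod :=
  pshift (quot_pmod (pruK M (double_ge0 a0))) (- a).

(** When K = 0, the inclusion (I/K)(-a) = I(-a) -> M(-a). *)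
Definition pruning_incl (a : R) (a0 : 0 <= a) (M : pmod)
    (K0 : forall p x, x \in pruK M (double_ge0 a0) p -> x = 0) :
    pmor (pruning a0 M) (pshift M (- a)) :=
  shift_mor (pmor_comp (sub_incl (pruI M (double_ge0 a0))) (quot0_inv K0)) (- a).

Section DirectSum.
Variables (r : nat) (M : 'I_r -> pmod).

Definition dsum_elt p := {dffun forall l : 'I_r, M l p}.
HB.instance Definition _ p := Choice.on (dsum_elt p).

Section Space.
Variable p : 'rV[R]_d.
Implicit Types x y z : dsum_elt p.

Definition dsum_zero : dsum_elt p := [ffun l => 0].
Definition dsum_opp x : dsum_elt p := [ffun l => - x l].
Definition dsum_add x y : dsum_elt p := [ffun l => x l + y l].
Definition dsum_scale a x : dsum_elt p := [ffun l => a *: x l].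

Lemma dsum_addA : associative dsum_add.
Proof. by move=> x y z; apply/ffunP => l; rewrite !ffunE addrA. Qed.

Lemma dsum_addC : commutative dsum_add.
Proof. by move=> x y; apply/ffunP => l; rewrite !ffunE addrC. Qed.

Lemma dsum_add0 : left_id dsum_zero dsum_add.
Proof. by move=> x; apply/ffunP => l; rewrite !ffunE add0r. Qed.

Lemma dsum_addN : left_inverse dsum_zero dsum_opp dsum_add.
Proof. by move=> x; apply/ffunP => l; rewrite !ffunE addNr. Qed.

HB.instance Definition _ := GRing.isZmodule.Build (dsum_elt p)
  dsum_addA dsum_addC dsum_add0 dsum_addN.

Lemma dsum_scaleA a b x : dsum_scale a (dsum_scale b x) = dsum_scale (a * b) x.
Proof. by apply/ffunP => l; rewrite !ffunE scalerA. Qed.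

Lemma dsum_scale1 : left_id 1 dsum_scale.
Proof. by move=> x; apply/ffunP => l; rewrite !ffunE scale1r. Qed.

Lemma dsum_scaleDr : right_distributive dsum_scale +%R.
Proof. by move=> a x y; apply/ffunP => l; rewrite !ffunE scalerDr. Qed.

Lemma dsum_scaleDl x : {morph dsum_scale^~ x : a b / a + b}.
Proof. by move=> a b; apply/ffunP => l; rewrite !ffunE scalerDl. Qed.

HB.instance Definition _ := GRing.Zmodule_isLmodule.Build k (dsum_elt p)
  dsum_scaleA dsum_scale1 dsum_scaleDr dsum_scaleDl.

Section Coord.
Variable l : 'I_r.

Definition dsum_coord (x : dsum_elt p) : M l p := x l.

Lemma dsum_coord_linear : linear dsum_coord.
Proof. by move=> a x y; rewrite /dsum_coord !ffunE. Qed.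

HB.instance Definition _ := GRing.isLinear.Build k (dsum_elt p) (M l p) _
  dsum_coord dsum_coord_linear.
End Coord.
End Space.

Section Map.
Variables (p q : 'rV[R]_d) (h : ple p q).

Definition dsum_map (x : dsum_elt p) : dsum_elt q := [ffun l => pmap (M l) h (x l)].

Lemma dsum_map_linear : linear dsum_map.
Proof. by move=> a x y; apply/ffunP => l; rewrite !ffunE linearP. Qed.

HB.instance Definition _ := GRing.isLinear.Build k (dsum_elt p) (dsum_elt q) _
  dsum_map dsum_map_linear.
End Map.

Let dsum_space p : lmodType k := dsum_elt p.
Let dsum_pmap p q (h : ple p q) : {linear dsum_space p -> dsum_space q} := dsum_map h.

Lemma dsum_pmap_id p (h : ple p p) x : dsum_pmap h x = x.
Proof. by apply/ffunP => l; rewrite ffunE pmap_id. Qed.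

Lemma dsum_pmap_comp p q s (pq : ple p q) (qs : ple q s) (ps : ple p s) x :
  dsum_pmap qs (dsum_pmap pq x) = dsum_pmap ps x.
Proof. by apply/ffunP => l; rewrite !ffunE (pmap_comp _ _ ps). Qed.

Definition dsum : pmod := Pmod dsum_pmap_id dsum_pmap_comp.

Section Projection.
Variable l : 'I_r.

Let proj_at p : {linear dsum p -> M l p} := @dsum_coord p l.

Lemma dsum_proj_nat p q (h : ple p q) x :
  proj_at q (pmap dsum h x) = pmap (M l) h (proj_at p x).
Proof. by rewrite /= /dsum_coord ffunE. Qed.

Definition dsum_proj : pmor dsum (M l) := Pmor dsum_proj_nat.
End Projection.
End DirectSum.

Record upset := Upset {
  upset_set :> set 'rV[R]_d;
  upsetP : forall p q, upset_set p -> ple p q -> upset_set q }.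

Section UpsetOps.

Lemma upset_shiftP (U : upset) e p q :
  upset_set U (padd p e) -> ple p q -> upset_set U (padd q e).
Proof. by move=> Up pq; apply: upsetP Up _; exact: ple_padd2r. Qed.

Definition upset_shift (U : upset) e : upset :=
  @Upset [set p | upset_set U (padd p e)] (@upset_shiftP U e).

Lemma upset_bigcapP I (J : set I) (U : I -> upset) p q :
  (\bigcap_(i in J) U i) p -> ple p q -> (\bigcap_(i in J) U i) q.
Proof. by move=> Up pq i Ji; apply: upsetP (Up i Ji) pq. Qed.

Definition upset_bigcap I (J : set I) (U : I -> upset) : upset :=
  Upset (@upset_bigcapP I J U).

End UpsetOps.

Definition indic_space (b : bool) : lmodType k :=
  if b then (k^o : lmodType k) else ('rV[k]_0 : lmodType k).

Definition indic_map (b c : bool) : indic_space b -> indic_space c :=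
  match b, c with
  | true, true => id
  | _, _ => fun=> 0
  end.

Lemma indic_map_linear b c : linear (@indic_map b c).
Proof. by case: b; case: c => a x y //=; rewrite scaler0 addr0. Qed.

HB.instance Definition _ b c := GRing.isLinear.Build k
  (indic_space b) (indic_space c) _ (@indic_map b c) (@indic_map_linear b c).

Lemma indic_space0 (x : indic_space false) : x = 0.
Proof. by apply/rowP => -[]. Qed.

Section UpsetModule.
Variable U : upset.

Let up_space p : lmodType k := indic_space `[< upset_set U p >].
Let up_pmap p q (_ : ple p q) : {linear up_space p -> up_space q} :=
  @indic_map `[< upset_set U p >] `[< upset_set U q >].

Lemma up_pmap_id p (h : ple p p) x : up_pmap h x = x.
Proof.
move: x; rewrite /up_pmap /up_space; case: `[< upset_set U p >] => //= x.
by rewrite [RHS]indic_space0.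
Qed.

Lemma up_pmap_comp p q s (pq : ple p q) (qs : ple q s) (ps : ple p s) x :
  up_pmap qs (up_pmap pq x) = up_pmap ps x.
Proof.
have Upq : `[< upset_set U p >] -> `[< upset_set U q >].
  by move=> /asboolP Up; apply/asboolP; exact: upsetP Up pq.
move: x Upq; rewrite /up_pmap /up_space.
case: `[< upset_set U p >]; case: `[< upset_set U q >]; case: `[< upset_set U s >] => //= x Upq.
by have := Upq isT.
Qed.

Definition upset_pmod : pmod := Pmod up_pmap_id up_pmap_comp.

Lemma supp_upset_pmod : supp upset_pmod = U :> set _.
Proof.
apply/seteqP; split=> p; rewrite /supp /= /up_space.
  case=> x; move: x; case: asboolP => // _ x.
  by rewrite [x]indic_space0.
by move=> Up; case: asboolP => // _; exists (1 : k^o); apply/eqP; exact: oner_neq0.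
Qed.

Lemma upset_pmap_inj p q (h : ple p q) x : pmap upset_pmod h x = 0 -> x = 0.
Proof.
have Upq : `[< upset_set U p >] -> `[< upset_set U q >].
  by move=> /asboolP Up; apply/asboolP; exact: upsetP Up h.
move: x Upq; rewrite /= /up_pmap /up_space.
case: `[< upset_set U p >]; case: `[< upset_set U q >] => //= x Upq.
- by have := Upq isT.
- by move=> _; exact: indic_space0.
- by move=> _; exact: indic_space0.
Qed.

End UpsetModule.

Lemma supp_shift_upset (U : upset) e :
  supp (pshift (upset_pmod U) e) = upset_shift U e :> set _.
Proof.
have := supp_upset_pmod U => /seteqP[sU Us]; apply/seteqP; split=> p.
  by move=> Up; apply: sU.
by move=> Up; apply: Us.
Qed.

(** The submodule of M that is M_p for p in V and 0 elsewhere. If M is an upset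
    module whose support contains V, this is the upset module of V, viewed as a
    submodule of M. *)
Section UpsetSub.
Variables (M : pmod) (V : upset).

Let upset_sub_at p : {pred M p} := [pred x | `[< upset_set V p >] || (x == 0)].

Lemma upset_sub_closed p : subsemimod_closed (@upset_sub_at p).
Proof.
rewrite /upset_sub_at; split; first split; first by rewrite inE eqxx orbT.
- move=> x y; rewrite !inE; case: asboolP => //= _ /eqP-> /eqP->.
  by rewrite addr0.
- move=> a x; rewrite !inE; case: asboolP => //= _ /eqP->.
  by rewrite scaler0.
Qed.

Lemma upset_sub_stable p q (h : ple p q) x :
  x \in @upset_sub_at p -> pmap M h x \in @upset_sub_at q.
Proof.
rewrite !inE => /orP[/asboolP Vp|/eqP->]; last by rewrite linear0 eqxx orbT.
by apply/orP; left; apply/asboolP; exact: upsetP Vp h.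
Qed.

Definition upset_sub : submodule M := Submodule upset_sub_closed upset_sub_stable.
End UpsetSub.

Section UpsetSubIso.
Variables (U V : upset) (e : R).
Hypothesis VU : V `<=` upset_shift U e.

Let N := sub_pmod (upset_sub (pshift (upset_pmod U) e) V).

Let iso_at p : {linear N p -> upset_pmod V p} :=
  @indic_map `[< upset_set U (padd p e) >] `[< upset_set V p >]
  \o sub_incl (upset_sub (pshift (upset_pmod U) e) V) p.

Lemma upset_sub_iso_nat p q (h : ple p q) x :
  iso_at q (pmap N h x) = pmap (upset_pmod V) h (iso_at p x).
Proof.
have Upq : `[< upset_set U (padd p e) >] -> `[< upset_set U (padd q e) >].
  by move=> /asboolP Up; apply/asboolP; apply: upsetP Up _; exact: ple_padd2r.
have Vpq : `[< upset_set V p >] -> `[< upset_set V q >].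
  by move=> /asboolP Up; apply/asboolP; exact: upsetP Up h.
case: x => /= x; rewrite inE /=; move: x Upq Vpq.
case: `[< upset_set U (padd p e) >]; case: `[< upset_set U (padd q e) >];
  case: `[< upset_set V p >]; case: `[< upset_set V q >] => //= x Upq Vpq.
all: try by have := Upq isT.
all: try by have := Vpq isT.
by move=> /eqP->.
Qed.

Lemma upset_sub_iso : pmod_iso N (upset_pmod V).
Proof.
exists (Pmor upset_sub_iso_nat) => p.
have VUp : `[< upset_set V p >] -> `[< upset_set U (padd p e) >].
  by move=> /asboolP Vp; apply/asboolP; exact: VU.
have mem_back y : @indic_map `[< upset_set V p >] `[< upset_set U (padd p e) >] y
    \in upset_sub (pshift (upset_pmod U) e) V p.
  rewrite inE /=; move: y VUp; case: `[< upset_set V p >] => //= y _.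
exists (fun y => SubElt (mem_back y)) => [[/= x xV]|/= y] /=.
  apply: val_inj => /=; move: xV; rewrite inE /=; move: x VUp {mem_back}.
  case: `[< upset_set V p >]; case: `[< upset_set U (padd p e) >] => //= x VUp.
  - by have := VUp isT.
  - by move=> /eqP->.
  - by move=> _; rewrite [x]indic_space0.
move: y VUp {mem_back}.
case: `[< upset_set V p >]; case: `[< upset_set U (padd p e) >] => //= y VUp.
- by have := VUp isT.
- by rewrite [y]indic_space0.
- by rewrite [y]indic_space0.
Qed.
End UpsetSubIso.

Section PruneUpset.
Variables (r : nat) (U : 'I_r -> upset) (a : R) (a0 : 0 <= a).

Definition upset_sum : pmod := dsum (fun l => upset_pmod (U l)).

Lemma pruK_upset_sum p x :
  x \in pruK upset_sum (double_ge0 a0) p -> x = 0.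
Proof.
have [_ Ksm] := pruK_smallest upset_sum (double_ge0 a0).
move=> /(Ksm (zero_sub _)); rewrite inE => H; apply/eqP/H => {x H}.
move=> f {}p x /asboolP[y]; rewrite inE => /eqP-> /= e.
rewrite inE; apply/eqP/val_inj/ffunP => l /=.
rewrite [RHS]ffunE; apply: (@upset_pmap_inj _ _ _ (ple_paddr p (double_ge0 a0))).
move: e; rewrite !linear0 => /ffunP/(_ l); rewrite !ffunE => e.
by rewrite -e.
Qed.

(** Pru_a(M) regarded as a submodule of M(-a). *)
Definition pruning_upset_incl :
    pmor (pruning a0 upset_sum) (pshift upset_sum (- a)) :=
  pruning_incl pruK_upset_sum.

(** The graph G(M, a): there is an edge l1 -> l2 iff M_{l1} is contained in
    M_{l2}(2 a). *)
Definition pru_edge : rel 'I_r := fun l1 l2 =>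
  `[< supp (upset_pmod (U l1)) `<=` supp (pshift (upset_pmod (U l2)) (2 * a)) >].

Definition pru_reach (l1 : 'I_r) : set 'I_r := [set l | connect pru_edge l1 l].

End PruneUpset.

End Modules.

(* Main.v *)
Require Import Defs.
From HB Require Import structures.
From mathcomp Require Import all_boot all_order all_algebra.
From mathcomp Require Import boolp classical_sets reals.

(** The submodule [I] of the pruning is itself a direct sum: its summand of
    index [l] is the upset module of [V_l], the intersection of the [U_m] over
    all [m] reachable from [l].  Since [K = 0], projecting [I(-a)] onto one
    summand gives the theorem.

    [I] is no larger ([pruI_sub]).  An edge [l -> m] provides the morphism
    [M -> M_l -> M_m(2a) -> M(2a)], which is injective on [M_l].  If [x] in [I]
    has a nonzero [l]-th coordinate, then its image under this morphism comes
    from an element of [I] at the same point, whose [m]-th coordinate has to be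
    nonzero.  Walking along a path, every [U_m] with [m] reachable from [l]
    contains the point where [x] lives.

    [I] is no smaller ([sub_pruI]), because the direct sum of the [V_l] meets
    the condition that defines [I].  Two points of [R^d] have a common upper
    bound and the structure maps of upset modules are injective, so a morphism
    [M_l -> M_m(2a)] that is nonzero at one point is nonzero on all of [U_l]
    ([upset_pmor_sub]), which makes [l -> m] an edge and [V_l] a subset of
    [V_m].  A coordinate [f(x)_m] can thus be nonzero only at points of [V_m],
    and there it lifts along [M_m -> M_m(2a)]. *)

Set Implicit Arguments.
Unset Strict Implicit.
Unset Printing Implicit Defensive.

Import Order.TTheory GRing.Theory Num.Theory.
Local Open Scope ring_scope.
Local Open Scope classical_set_scope.

Lemma ple_ub (R : realType) (d : nat) (p q : 'rV[R]_d) :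
  exists s, ple p s /\ ple q s.
Proof.
exists (\row_i Num.max (p 0 i) (q 0 i)).
by split; apply/forallP => i; rewrite mxE le_max lexx ?orbT.
Qed.

(** * Morphisms between upset modules *)

Section UpsetModules.
Variables (R : realType) (d : nat) (k : fieldType).
Implicit Types (U W : upset R d) (p q : 'rV[R]_d).

Lemma upset_neq0 U p (x : upset_pmod k U p) : x != 0 -> upset_set U p.
Proof.
move=> x0; have : supp (upset_pmod k U) p by exists x; exact/eqP.
by rewrite supp_upset_pmod.
Qed.

Lemma upset_pmap_surj U p q (h : ple p q) (y : upset_pmod k U q) :
  upset_set U p -> exists x, Defs.pmap (upset_pmod k U) h x = y.
Proof.
move=> Up; have Uq : upset_set U q := upsetP Up h.
move: y; rewrite /=.
by case: (asboolP (upset_set U p)) => // _; case: asboolP Uq => // _ _ y; exists y.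
Qed.

(** Both values at [p] and at [q] map to the value at a common upper bound,
    so they vanish together. *)
Lemma upset_pmor_sub U W (e : R)
    (f : pmor (upset_pmod k U) (pshift (upset_pmod k W) e)) p x :
  f p x != 0 -> U `<=` upset_shift W e.
Proof.
move=> fx0 q Uq; have [s [ps qs]] := ple_ub p q.
have [z ez] := upset_pmap_surj qs (Defs.pmap (upset_pmod k U) ps x) Uq.
apply: (@upset_neq0 W (padd q e) (f q z)); apply: contraNneq fx0 => fz0.
apply/eqP; apply: (@upset_pmap_inj _ _ _ W _ _ (ple_padd2r e ps)).
have /= := pmor_nat f ps x.
by rewrite -ez (pmor_nat f qs z) fz0 linear0 => <-.
Qed.

Section Inclusion.
Variables (U W : upset R d) (e : R).
Hypothesis UW : U `<=` upset_shift W e.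

Let incl_at p : {linear upset_pmod k U p -> pshift (upset_pmod k W) e p} :=
  @indic_map k `[< upset_set U p >] `[< upset_set W (padd p e) >].

(** The square could only fail at [p <= q] in [U] with [q + e] in [W] but
    [p + e] outside; [UW] excludes this. *)
Lemma upset_incl_nat p q (h : ple p q) x :
  incl_at q (Defs.pmap (upset_pmod k U) h x) =
  Defs.pmap (pshift (upset_pmod k W) e) h (incl_at p x).
Proof.
have Upq : `[< upset_set U p >] -> `[< upset_set U q >].
  by move=> /asboolP Up; apply/asboolP; exact: upsetP Up h.
have UWp : `[< upset_set U p >] -> `[< upset_set W (padd p e) >].
  by move=> /asboolP Up; apply/asboolP; exact: UW.
move: x Upq UWp; rewrite /= /incl_at.
case: `[< upset_set U p >]; case: `[< upset_set U q >];
  case: `[< upset_set W (padd p e) >]; case: `[< upset_set W (padd q e) >] => //= x Upq UWp.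
all: by [have := Upq isT | have := UWp isT].
Qed.

Definition upset_incl : pmor (upset_pmod k U) (pshift (upset_pmod k W) e) :=
  Pmor upset_incl_nat.

Lemma upset_incl_neq0 p x : x != 0 -> upset_incl p x != 0.
Proof.
move=> x0; have Up := upset_neq0 x0; have Wp := UW Up.
move: x x0; rewrite /= /incl_at.
by case: asboolP Up => // _ _; case: asboolP Wp.
Qed.
End Inclusion.

End UpsetModules.

(** * Direct sums *)

Section DirectSums.
Variables (R : realType) (d : nat) (k : fieldType) (r : nat).
Variable M : 'I_r -> pmod R d k.

Section Injection.
Variable l : 'I_r.

Definition dsum_single p (x : M l p) : dsum M p :=
  [ffun m => dfwith (fun m => 0 : M m p) x m].

Lemma dsum_single_in p (x : M l p) : dsum_single x l = x.
Proof. by rewrite ffunE dfwith_in. Qed.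

Lemma dsum_single_out p (x : M l p) m : l != m -> dsum_single x m = 0.
Proof. by move=> lm; rewrite ffunE dfwith_out. Qed.

Lemma dsum_single_linear p : linear (@dsum_single p).
Proof.
move=> b x y; apply/ffunP => m; rewrite !ffunE.
have [<-|lm] := eqVneq l m; first by rewrite !dfwith_in.
by rewrite !dfwith_out // scaler0 addr0.
Qed.

HB.instance Definition _ p := GRing.isLinear.Build k (M l p) (dsum M p) _
  (@dsum_single p) (@dsum_single_linear p).

Let inj_at p : {linear M l p -> dsum M p} := @dsum_single p.

Lemma dsum_inj_nat p q (h : ple p q) x :
  inj_at q (Defs.pmap (M l) h x) = Defs.pmap (dsum M) h (inj_at p x).
Proof.
apply/ffunP => m; rewrite [RHS]ffunE /=.
have [<-|lm] := eqVneq l m; first by rewrite !dsum_single_in.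
by rewrite !dsum_single_out // linear0.
Qed.

Definition dsum_inj : pmor (M l) (dsum M) := Pmor dsum_inj_nat.
End Injection.

Lemma dsum_decomp p (x : dsum M p) : x = \sum_l dsum_inj l p (x l).
Proof.
apply/ffunP => m; rewrite -[RHS]/(dsum_proj M m p _) linear_sum (bigD1 m) //=.
rewrite big1 ?addr0 => [|l lm]; rewrite /dsum_coord ?dsum_single_in //.
by rewrite dsum_single_out.
Qed.

Section SubSum.
Variable N : forall l, submodule (M l).

Let dsum_sub_at p : {pred dsum M p} :=
  [pred x : dsum M p | [forall l, x l \in N l p]].

Lemma dsum_sub_closed p : subsemimod_closed (@dsum_sub_at p).
Proof.
split; first split.
- by apply/forallP => l; rewrite ffunE rpred0.
- move=> x y /forallP xN /forallP yN; apply/forallP => l.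
  by rewrite ffunE; apply: rpredD; [exact: xN | exact: yN].
- by move=> b x /forallP xN; apply/forallP => l; rewrite ffunE; apply/rpredZ/xN.
Qed.

Lemma dsum_sub_stable p q (h : ple p q) x :
  x \in @dsum_sub_at p -> Defs.pmap (dsum M) h x \in @dsum_sub_at q.
Proof.
by move=> /forallP xN; apply/forallP => l; rewrite ffunE; apply/sub_stable/xN.
Qed.

Definition dsum_sub : submodule (dsum M) :=
  Submodule dsum_sub_closed dsum_sub_stable.

Lemma dsum_inj_sub l p (x : M l p) : x \in N l p -> dsum_inj l p x \in dsum_sub p.
Proof.
move=> xN; apply/forallP => m /=.
have [<-|lm] := eqVneq l m; first by rewrite dsum_single_in.
by rewrite dsum_single_out // rpred0.
Qed.
End SubSum.

End DirectSums.

(** * The submodule [I] of a sum of upset modules *)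

Section Pruning.
Variables (R : realType) (k : fieldType) (d : nat) (a : R) (a0 : 0 <= a).
Variables (r : nat) (U : 'I_r -> upset R d).

Local Notation M := (fun l => upset_pmod k (U l)).
Local Notation I := (pruI (upset_sum k U) (double_ge0 a0)).

Lemma pru_edgeE l m : pru_edge k U a l m <-> U l `<=` upset_shift (U m) (2 * a).
Proof. by rewrite /pru_edge supp_upset_pmod supp_shift_upset; split=> /asboolP. Qed.

Definition reach_upset (l : 'I_r) : upset R d := upset_bigcap (pru_reach k U a l) U.

Lemma reach_upset_edge l m :
  pru_edge k U a l m -> reach_upset l `<=` reach_upset m.
Proof.
move=> lm p Vp n mn; apply: Vp; exact: connect_trans (connect1 lm) mn.
Qed.

Definition reach_sub : submodule (upset_sum k U) :=
  dsum_sub (fun l => upset_sub (upset_pmod k (U l)) (reach_upset l)).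

Lemma mem_reach_sub p (x : upset_sum k U p) :
  x \in reach_sub p <-> forall l, x l != 0 -> upset_set (reach_upset l) p.
Proof.
split=> [/forallP xV l xl0|xV].
  by have /orP[/asboolP//|/eqP xl] := xV l; rewrite xl eqxx in xl0.
apply/forallP => l; apply/orP.
by have [xl0|/xV Vp] := eqVneq (x l) 0; [right; exact/eqP | left; exact/asboolP].
Qed.

(** The condition on [I], applied to the morphism that carries the [l]-th
    coordinate to the [m]-th one, yields [y]: its [m]-th coordinate lies over
    the nonzero [x l]. *)
Lemma pruI_edge p x l m : x \in I p -> x l != 0 -> pru_edge k U a l m ->
  exists2 y, y \in I p & y m != 0.
Proof.
move=> xI xl0 /pru_edgeE lm.
have [Icond _] := pruI_largest (upset_sum k U) (double_ge0 a0).
pose f : pmor (upset_sum k U) (pshift (upset_sum k U) (2 * a)) :=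
  pmor_comp (shift_mor (dsum_inj M m) (2 * a))
    (pmor_comp (upset_incl k lm) (dsum_proj M l)).
have /asboolP[y yI ey] : f p x \in sub_image (transition _ (double_ge0 a0)) I p.
  by apply: (Icond f); apply/asboolP; exists x.
exists y => //; apply: contraNneq (upset_incl_neq0 lm xl0) => ym0.
have <- : f p x m = upset_incl k lm p (x l) by exact: dsum_single_in.
by rewrite -ey /= ffunE ym0 linear0.
Qed.

(** At the end [n] of a path, some element of [I] at the same point [p] has a
    nonzero [n]-th coordinate, which forces [p] into [U_n]. *)
Lemma pruI_sub : sub_le I reach_sub.
Proof.
move=> p x xI; apply/mem_reach_sub => l xl0 m /connectP[s sP ->].
elim: s l x xI xl0 sP => [|n s IHs] l x xI xl0 /=.
  by move=> _; exact: upset_neq0 xl0.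
by move=> /andP[ln sP]; have [y yI yn0] := pruI_edge xI xl0 ln; exact: IHs yI yn0 sP.
Qed.

(** A nonzero coordinate [f(x)_m] has a nonzero contribution from some [x_l].
    By rigidity of morphisms [l -> m] is then an edge, so the point, which lies
    in [V_l], lies in [V_m]; there the coordinate lifts along the structure map
    of [M_m], which is surjective from points of [U_m]. *)
Lemma sub_pruI : sub_le reach_sub I.
Proof.
apply: (pruI_largest (upset_sum k U) (double_ge0 a0)).2.
move=> f p _ /asboolP[x /mem_reach_sub xV <-].
have fV m : f p x m != 0 -> upset_set (reach_upset m) p.
  move=> fxm0.
  pose g l := pmor_comp (shift_mor (dsum_proj M m) (2 * a))
    (pmor_comp f (dsum_inj M l)).
  have : \sum_l g l p (x l) != 0.
    apply: contraNneq fxm0 => g0; apply/eqP; rewrite -g0.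
    by rewrite {1}[x]dsum_decomp linear_sum -[LHS]/(dsum_proj M m _ _) linear_sum.
  have [l gl0|g0] := pickP (fun l => g l p (x l) != 0); last first.
    by rewrite big1 ?eqxx // => l _; apply/eqP; rewrite -[_ == _]negbK g0.
  move=> _; apply: (@reach_upset_edge l).
    by apply/pru_edgeE; exact: upset_pmor_sub gl0.
  by apply: xV; apply: contraNneq gl0 => ->; rewrite linear0.
(* A vanishing coordinate lifts to 0, so that the lift stays in [V_m]. *)
have lift m : {y : upset_pmod k (U m) p |
    Defs.pmap (upset_pmod k (U m)) (ple_paddr p (double_ge0 a0)) y = f p x m /\
    (y != 0 -> upset_set (reach_upset m) p)}.
  apply: cid; have [->|fxm0] := eqVneq (f p x m) 0.
    by exists 0; rewrite linear0 eqxx.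
  have Vp := fV m fxm0.
  have Up : upset_set (U m) p by apply: Vp; exact: connect0.
  have [y ey] := upset_pmap_surj (ple_paddr p (double_ge0 a0)) (f p x m) Up.
  by exists y.
apply/asboolP; exists ([ffun m => sval (lift m)] : dsum M p).
  by apply/mem_reach_sub => m; rewrite ffunE; exact: (svalP (lift m)).2.
by apply/ffunP => m; rewrite !ffunE; exact: (svalP (lift m)).1.
Qed.

(** As [K = 0], a class in [I/K] has a single representative, so the inclusion
    of the pruning returns exactly the elements of [I]. *)
Lemma mem_im_pruning p x :
  x \in im (pruning_upset_incl k U a0) p <-> x \in I (padd p (- a)).
Proof.
have K0 := @pruK_upset_sum _ _ k _ U a a0.
split=> [/asboolP[u _ <-]|xI]; first exact: (sub_valP (quot0_inv K0 _ u)).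
apply/asboolP.
exists (quot_proj (pruK (upset_sum k U) (double_ge0 a0)) _ (SubElt xI)) => //.
rewrite /pruning_upset_incl /pruning_incl /=.
by have /(congr1 val) := quot_projK K0 (SubElt xI).
Qed.

End Pruning.

(** * Projection of the pruning onto a summand *)

Theorem theorem3p9 (R : realType) (k : fieldType) (d : nat) (hd : (1 <= d)%N)
    (a : R) (a0 : 0 <= a) (r : nat) (U : 'I_r -> upset R d) (l1 : 'I_r) :
  let M l := upset_pmod k (U l) in
  sub_eq
    (sub_image (shift_mor (dsum_proj M l1) (- a)) (im (pruning_upset_incl k U a0)))
    (upset_sub (pshift (M l1) (- a))
       (upset_bigcap (pru_reach k U a l1) (fun l => upset_shift (U l) (- a)))).
Proof.
move=> M p y; apply/idP/idP.
  move=> /asboolP[x /mem_im_pruning/pruI_sub/forallP/(_ l1) xV <-].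
  exact: xV.
move=> yV; apply/asboolP; exists (dsum_inj M l1 (padd p (- a)) y).
  by apply/mem_im_pruning/sub_pruI/dsum_inj_sub.
exact: (@dsum_single_in _ _ _ _ M l1 (padd p (- a)) y).
Qed.
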